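(* Let $(\alpha,\gamma)$ be a pair of real-valued random variables such that $\mathbb{P}(|\alpha|\ne 1)>0$ and $\mathbb{E}\{\ln|\alpha|\}=0$. Then any bounded solution $y:\mathbb{R}\to\mathbb{R}$ of the equation $$y'(x)+y(x)=\mathbb{E}\{y(\alpha(x-\gamma))\},\qquad x\in\mathbb{R},$$ is constant.
   Context: A bounded solution is a bounded differentiable function $y:\mathbb{R}\to\mathbb{R}$ satisfying the equation at every $x\in\mathbb{R}$. $\mathbb{E}$ denotes expectation with respect to the joint distribution of $(\alpha,\gamma)$, an arbitrary probability measure on $\mathbb{R}^2$ subject to the stated hypotheses. The condition $\mathbb{E}\{\ln|\alpha|\}=0$ means that $\ln|\alpha|$ is integrable with mean zero (in particular $\alpha\neq0$ almost surely). *)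

(* Defs.v *)
From HB Require Import structures.
From mathcomp Require Import all_boot all_order all_algebra.
From mathcomp Require Import all_classical all_reals all_analysis.

Set Implicit Arguments.
Unset Strict Implicit.
Unset Printing Implicit Defensive.

Import Order.TTheory GRing.Theory Num.Theory.
Import numFieldNormedType.Exports.

Local Open Scope classical_set_scope.
Local Open Scope ring_scope.

(* The expectation takes values in [\bar R], so the equation is stated there.
   For [y] bounded and differentiable the integrand is bounded and measurable,
   so the expectation is always a finite integral. *)
Definition bounded_solution (R : realType) (d : measure_display)
    (T : measurableType d) (P : probability T R) (alpha gamma : {RV P >-> R})
    (y : R -> R) : Prop :=
  [/\ bounded_fun y,
      forall x : R, derivable y x 1 &
      forall x : R, (derive1 y x + y x : R)%:E =
                ('E_P[fun t => y (alpha t * (x - gamma t))%R])%E].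

(* Here [lne 0 = -oo] (whereas [ln 0 = 0]), so integrability of
   [lne `|alpha|] forces [alpha != 0] almost surely. *)
Definition log_abs_centered (R : realType) (d : measure_display)
    (T : measurableType d) (P : probability T R) (alpha : {RV P >-> R}) : Prop :=
  P.-integrable setT (fun t => lne `|alpha t|%:E) /\
  (\int[P]_t lne `|alpha t|%:E = 0)%E.

(* Main.v *)
(* Let f(s) be the modulus of continuity of y at scale e^s and xi = ln|alpha|.
   A maximum principle for D' + D, with D(x) = y(x + h) - y(x), turns the equation
   into f(s) <= E f(s + xi). Let H be a primitive of the bounded nondecreasing
   function f; it is convex. Then Phi(s) = E[H(s + xi) - H(s)] is nonnegative
   (Jensen, as E xi = 0) and nondecreasing (its derivative is E f(s + xi) - f(s)),
   and it tends to f(+oo) E xi = 0 at +oo, so Phi = 0. Equality in Jensen's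
   inequality then says that f is constant on [s, s + xi] almost surely; as xi > 0
   with positive probability, f is constant, hence equal to f(-oo) = 0. This
   replaces the recurrence of the random walk with steps xi. *)
Require Import Defs.
From HB Require Import structures.
From mathcomp Require Import all_boot all_order all_algebra.
From mathcomp Require Import all_classical all_reals all_analysis.
From mathcomp Require Import measurable_realfun lra.
Import Order.TTheory GRing.Theory Num.Theory.
Import numFieldNormedType.Exports.
Local Open Scope classical_set_scope.
Local Open Scope ring_scope.

(** * Bounded monotone functions that are subharmonic for a centered random step *)

Section subharmonic.
Context {R : realType} {d : measure_display} {T : measurableType d}.
Variables (P : probability T R) (xi : T -> R).
Hypothesis mxi : measurable_fun setT xi.
Hypothesis ixi : P.-integrable setT (EFin \o xi).
Hypothesis Exi0 : \int[P]_t xi t = 0.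
Variables (f H : R -> R) (M : R).
Hypothesis f_nd : {homo f : s t / s <= t}.
Hypothesis f_ge0 : forall s, 0 <= f s.
Hypothesis f_le : forall s, f s <= M.
(** [f s] is a subgradient of [H] at [s]: convexity and calculus enter this section through this
    inequality alone. *)
Hypothesis H_ge : forall s x, f s * x <= H (s + x) - H s.

Let H_le s x : H (s + x) - H s <= f (s + x) * x.
Proof. by have := H_ge (s + x) (- x); rewrite addrK; lra. Qed.

Let mH : measurable_fun setT H.
Proof.
apply: nondecreasing_measurable => // a b ab.
have := H_ge a (b - a); rewrite subrKC -[H a <= _]subr_ge0.
by apply: le_trans; rewrite mulr_ge0 ?f_ge0// subr_ge0.
Qed.

Let mf : measurable_fun setT f.
Proof. exact: nondecreasing_measurable. Qed.

Let mshift s : measurable_fun setT (fun t => s + xi t).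
Proof. exact: measurable_funD. Qed.

Let H_abs s x : `|H (s + x) - H s| <= M * `|x|.
Proof.
have := H_ge s x; have := H_le s x.
have := f_ge0 s; have := f_le s; have := f_ge0 (s + x); have := f_le (s + x).
by case: (ger0P x) => x0; rewrite ler_norml => *; nra.
Qed.

Let integrable_lin (g : T -> R) (a b : R) : measurable_fun setT g ->
  (forall t, `|g t| <= a * `|xi t| + b) -> P.-integrable setT (EFin \o g).
Proof.
move=> mg gab.
have ig : P.-integrable setT (EFin \o (fun t => a * `|xi t| + b)).
  have i1 : P.-integrable setT (EFin \o (fun t => a * `|xi t|)).
    apply: (@integrableZl _ _ _ P _ _ a (EFin \o (Num.norm \o xi))) => //.
    exact: integrable_norm.
  have i2 : P.-integrable setT (EFin \o cst b).
    exact: finite_measure_integrable_cst.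
  by apply: eq_integrable (integrableD measurableT i1 i2).
apply: le_integrable ig => //.
  exact/measurable_EFinP.
by move=> t _; rewrite /= lee_fin (le_trans (gab t))// ler_norm.
Qed.

Let k s t := H (s + xi t) - H s.

Let mk s : measurable_fun setT (k s).
Proof. by apply: measurable_funB => //; exact: measurableT_comp mH _. Qed.

Let ik s : P.-integrable setT (EFin \o k s).
Proof. by apply: (integrable_lin _ M 0 (mk s)) => t; rewrite addr0 H_abs. Qed.

Let mfs s : measurable_fun setT (fun t => f (s + xi t)).
Proof. exact: measurableT_comp. Qed.

Let ifs s : P.-integrable setT (EFin \o (fun t => f (s + xi t))).
Proof.
apply: (integrable_lin _ 0 M (mfs s)) => t.
by rewrite mul0r add0r ger0_norm.
Qed.

Let iZ (c : R) {g : T -> R} : P.-integrable setT (EFin \o g) ->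
  P.-integrable setT (EFin \o (fun t => c * g t)).
Proof. by move=> ig; apply: (@integrableZl _ _ _ P _ _ c (EFin \o g)). Qed.

Let icst (c : R) : P.-integrable setT (EFin \o cst c).
Proof. exact: finite_measure_integrable_cst. Qed.

Let Ecst (c : R) : \int[P]_t c = c.
Proof. by rewrite Rintegral_cst//= probability_setT mulr1. Qed.

Hypothesis f_sub : forall s, f s <= \int[P]_t f (s + xi t).

(* [Phi] is nonnegative by convexity of [H], nondecreasing by subharmonicity of
   [f] and vanishes at +oo, so it is zero: equality holds in [H_ge] a.s. *)
Let Phi s := \int[P]_t k s t.

Let Phi_ge0 s : 0 <= Phi s.
Proof.
rewrite -(mulr0 (f s)) -Exi0 -RintegralZl//.
by apply: le_Rintegral; [|exact: iZ|exact: ik|move=> t _; exact: H_ge].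
Qed.

(** A discrete form of Phi' = E f(s + xi) - f(s) >= 0. Subgradients bound the increment of [H] over
    a step [h] below by [h * f (s + xi t)] when it starts at [s + xi t], and above by
    [h * f (s + h)] when it starts at [s]; [f_sub] compares the means. *)
Let Phi_step (s h : R) : 0 <= h -> h * (f s - f (s + h)) <= Phi (s + h) - Phi s.
Proof.
move=> h0; rewrite /Phi -RintegralB//.
have -> : h * (f s - f (s + h)) = h * f s - h * f (s + h) by lra.
apply: (@le_trans _ _ (\int[P]_t (h * f (s + xi t) - h * f (s + h)))).
  rewrite RintegralB//; last 2 first.
  - exact: iZ.
  - exact: icst.
  by rewrite RintegralZl// Ecst lerB// ler_wpM2l.
apply: le_Rintegral => //.
- exact: (@integrableB _ _ _ P _ measurableT (EFin \o (fun t => h * f (s + xi t)))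
    (EFin \o cst (h * f (s + h))) (iZ _ (ifs s)) (icst _)).
- exact: (@integrableB _ _ _ P _ measurableT _ _ (ik (s + h)) (ik s)).
- move=> t _; rewrite /k.
  have := H_le s h; have := H_ge (s + xi t) h.
  rewrite [s + h + _]addrAC; lra.
Qed.

Let Phi_steps (s h : R) n : 0 <= h ->
  h * (f s - f (s + h *+ n)) <= Phi (s + h *+ n) - Phi s.
Proof.
move=> h0; elim: n => [|n ih]; first by rewrite mulr0n addr0 !subrr mulr0.
have := Phi_step (s + h *+ n) _ h0; rewrite -addrA -mulrSr.
by move: ih; lra.
Qed.

(* Subdividing [a, b] into n steps, the errors of [Phi_step] telescope to O(1/n). *)
Let Phi_nd : {homo Phi : a b / a <= b}.
Proof.
move=> a b ab; rewrite -subr_ge0.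
rewrite leNgt; apply/negP => z0.
have zN : 0 < - (Phi b - Phi a) by rewrite oppr_gt0.
have hn := truncnS_gt ((b - a) * M / - (Phi b - Phi a)).
set n := (Num.truncn _).+1 in hn.
have n0 : 0 < n%:R :> R by rewrite ltr0n.
have h0 : 0 <= (b - a) / n%:R by rewrite divr_ge0// subr_ge0.
have := Phi_steps a _ n h0.
rewrite -(mulr_natr ((b - a) / n%:R)) divfK ?gt_eqF// subrKC mulrAC ler_pdivrMr//.
move: hn; rewrite ltr_pdivrMr// => hn.
have : (b - a) * (f b - f a) <= (b - a) * M.
  by rewrite ler_wpM2l ?subr_ge0// lerBlDr (le_trans (f_le b))// lerDl.
lra.
Qed.

Let f_sup : has_sup (range f).
Proof. by split; [exists (f 0), 0|exists M => _ [x _ <-]]. Qed.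

(** [k n t] lies between [f n * xi t] and [f (n + xi t) * xi t], and both values of [f] tend to its
    supremum. *)
Let k_lim (t : T) : (k n%:R t)%:E @[n --> \oo] --> (sup (range f) * xi t)%:E.
Proof.
apply: cvg_EFin; first by near=> n.
apply/cvgrPdist_le => e e0.
(* The tolerance is divided by 1 + |xi| because the error in [f] gets multiplied by |xi|; the 1
   guards against xi = 0. *)
have [_ [x0 _ <-] hx] := sup_adherent (divr_gt0 e0 (ltr_wpDr (normr_ge0 (xi t)) ltr01)) f_sup.
near=> n => /=; rewrite /k.
have ubf x : f x <= sup (range f) by apply: ub_le_sup; [exact: (proj2 f_sup)|exists x].
have fn x : x0 <= x -> 0 <= sup (range f) - f x <= e / (1 + `|xi t|).
  move=> x0x; have := f_nd _ _ x0x; have := ubf x; lra.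
have nx : x0 + `|xi t| <= n%:R by near: n; exact: nbhs_infty_ger.
have n1 : x0 <= n%:R + xi t by have := ler_norm (- xi t); rewrite normrN; lra.
have n2 : x0 <= n%:R by have := normr_ge0 (xi t); lra.
have ee : e / (1 + `|xi t|) * `|xi t| <= e.
  have p1 : 0 < 1 + `|xi t| by rewrite ltr_wpDr.
  rewrite mulrAC ler_pdivrMr// ler_pM2l//; lra.
have := H_ge n%:R (xi t); have := H_le n%:R (xi t).
have := fn _ n1; have := fn _ n2; move: ee {hx fn}.
set a := e / _.
rewrite ler_norml.
case: (ger0P (xi t)) => x00 *; nra.
Unshelve. all: by end_near. Qed.

Let Phi_lim : Phi n%:R @[n --> \oo] --> (0 : R).
Proof.
have [] := @dominated_convergence _ T R P setT measurableT (fun n t => (k n%:R t)%:E)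
  (fun t => (sup (range f) * xi t)%:E) (fun t => (M * `|xi t|)%:E).
- by move=> n; exact/measurable_EFinP.
- by apply/measurable_EFinP; exact: measurable_funM.
- by apply: aeW => t _; exact: k_lim.
- exact: (iZ M (integrable_norm ixi)).
- by apply: aeW => t n _; rewrite /= lee_fin H_abs.
move=> _ _ h.
have : fine (\int[P]_t (k n%:R t)%:E)%E @[n --> \oo] -->
    fine (\int[P]_t (sup (range f) * xi t)%:E)%E.
  apply: fine_cvg; rewrite fineK//.
  have := @integrable_fin_num _ _ _ P setT measurableT _ (iZ (sup (range f)) ixi); exact.
rewrite -/(Rintegral _ _ _).
by rewrite RintegralZl// Exi0 mulr0.
Qed.

Let Phi0 s : Phi s = 0.
Proof.
apply/eqP; rewrite eq_le Phi_ge0 andbT.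
rewrite -(cvg_lim _ Phi_lim)//.
apply: limr_ge; first by apply/cvg_ex; exists 0; exact: Phi_lim.
by near=> n; apply: Phi_nd; near: n; exact: nbhs_infty_ger.
Unshelve. all: by end_near. Qed.

Let k_ae s : {ae P, forall t, k s t = f s * xi t}.
Proof.
pose g t := k s t - f s * xi t.
have g0 t : 0 <= g t by rewrite subr_ge0 H_ge.
have ig : P.-integrable setT (EFin \o g).
  exact: (@integrableB _ _ _ P _ _ (EFin \o k s) _ (ik s) (iZ (f s) ixi)).
have Eg : (\int[P]_t `|(g t)%:E| = 0)%E.
  under eq_integral do rewrite gee0_abs ?lee_fin//.
  rewrite -[LHS]fineK; last exact: (integrable_fin_num measurableT ig).
  rewrite -/(Rintegral P setT g) /g RintegralB//; last exact: iZ.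
  by rewrite -/(Phi s) Phi0 RintegralZl// Exi0 mulr0 subr0.
have mg : measurable_fun setT (EFin \o g) by apply: measurable_int ig.
have /(ae_eq_integral_abs P measurableT mg) := Eg.
apply: filterS => t /(_ I) [] /eqP; rewrite subr_eq0 => /eqP //.
Qed.

Hypothesis xi_neq0 : (0 < P [set t | xi t != 0%R])%E.

(** Otherwise, by a countable union over e = 1/(n+1), xi <= 0 almost surely; mean zero then forces
    xi = 0 almost surely, against [xi_neq0]. *)
Let xi_gt : exists2 e : R, 0 < e & ~ P.-negligible [set t | e < xi t].
Proof.
apply: contrapT => h.
have h1 n : P.-negligible [set t | n.+1%:R^-1 < xi t].
  by apply: contrapT => h2; apply: h; exists n.+1%:R^-1 => //; rewrite invr_gt0.
have := negligible_bigcup h1.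
rewrite (_ : \bigcup_k _ = [set t | 0 < xi t]); last first.
  apply/seteqP; split => t /=.
    by move=> [n _ /=]; apply: lt_trans; rewrite invr_gt0.
  move=> x0; exists (Num.truncn (xi t)^-1) => //=.
  by rewrite invf_plt ?posrE// truncnS_gt.
move=> neg.
have xi_le : {ae P, forall t, xi t <= 0}.
  by apply: negligibleS neg => t /= /negP; rewrite -ltNge.
have E0 : (\int[P]_t `|(xi t)%:E| = 0)%E.
  rewrite -[LHS]oppeK -integral_ge0N//.
  rewrite (@ae_eq_integral _ _ _ P setT (EFin \o xi)) //.
  - rewrite -[X in (- X)%E]fineK; last exact: (integrable_fin_num measurableT ixi).
    by rewrite -/(Rintegral P setT xi) Exi0 oppe0.
  - by apply/measurable_EFinP; apply: measurableT_comp => //; exact: measurableT_comp.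
  - exact/measurable_EFinP.
  - by apply: filterS xi_le => t xt _ /=; rewrite ler0_norm ?opprK.
have mx : measurable_fun setT (EFin \o xi) by exact/measurable_EFinP.
have /(ae_eq_integral_abs P measurableT mx) := E0.
move=> ae0.
have : P.-negligible [set t | xi t != 0].
  by apply: negligibleS ae0 => t /= /eqP xt /(_ I) [].
have mx0 : measurable [set t | xi t != 0].
  rewrite (_ : [set t | _] = xi @^-1` (~` [set 0])).
    by rewrite -[X in measurable X]setTI; apply: mxi => //; apply: measurableC.
  by apply/seteqP; split => t /= /eqP.
by move=> /(negligibleP P mx0) x0; move: xi_neq0; rewrite x0 ltxx.
Qed.

Lemma subharmonic_cst a b : f a = f b.
Proof.
have [e e0 hneg] := xi_gt.
(* If f(s) < f(s + e), then wherever xi > e, subgradients at [s] and [s + e] give H(s + xi) - H(s)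
   >= f(s) e + f(s + e)(xi - e) > f(s) xi, which [k_ae] allows only on a null set. *)
have step s : f (s + e) = f s.
  apply/le_anti/andP; split; last by rewrite f_nd ?lerDl ?ltW.
  rewrite leNgt; apply/negP => fs; apply: hneg.
  apply: negligibleS (k_ae s) => t /= ext; rewrite /k => kt.
  have := H_ge (s + e) (xi t - e); rewrite -addrA [e + _]addrC subrK.
  have := H_ge s e; nra.
have steps n s : f (s + e *+ n) = f s.
  by elim: n => [|n ih]; [rewrite addr0|rewrite mulrSr addrA step ih].
wlog ab : a b / a <= b.
  by move=> h; case: (leP a b) => [|/ltW] ab; [|symmetry]; exact: h.
apply/le_anti; rewrite (f_nd _ _ ab)/=.
(* Enough steps of length [e] lead from [a] beyond [b], and [f] is monotone. *)
rewrite -(steps (Num.truncn ((b - a) / e)).+1 a).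
apply: f_nd; rewrite -lerBlDl -(mulr_natr e) mulrC -ler_pdivrMr//.
by rewrite ltW// truncnS_gt.
Qed.

End subharmonic.

(** * Real calculus: mean values, primitives, and a maximum principle for D' + D *)

Section real_functions.
Context {R : realType}.
Implicit Types (f g H D : R -> R).

Lemma is_derive_MVT f g (a b : R) : (forall x : R, is_derive x 1 f (g x)) ->
  exists2 c, Num.min a b <= c <= Num.max a b & f b - f a = g c * (b - a).
Proof.
move=> fg.
have cf : continuous f.
  move=> x; apply/differentiable_continuous/derivable1_diffP.
  by have := fg x => -[].
have MVT_le (u v : R) : u <= v ->
    exists2 c, u <= c <= v & f v - f u = g c * (v - u).
  move=> uv.
  have [c cuv fc] := MVT_segment uv (fun x _ => fg x) (continuous_subspaceT cf).
  by exists c => //; move: cuv; rewrite in_itv.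
case: (leP a b) => [ab|/ltW ba]; first exact: MVT_le.
have [c cba fc] := MVT_le _ _ ba; exists c => //.
by rewrite -opprB fc -mulrN opprB.
Qed.

(** The increment is [f c * x] with [c] between [s] and [s + x]; for x < 0 both the order of [c] and
    [s] and the effect of multiplying by [x] are reversed. *)
Lemma derive_subgradient f H (s x : R) : {homo f : u v / u <= v} ->
  (forall u : R, is_derive u 1 H (f u)) -> f s * x <= H (s + x) - H s.
Proof.
move=> f_nd Hf.
have [c + ->] := is_derive_MVT H f s (s + x) Hf.
rewrite [s + x - s]addrAC subrr add0r.
have [x0|x0] := leP 0 x.
  rewrite min_l ?max_r ?lerDl// => /andP[sc _].
  by rewrite ler_wpM2r// f_nd.
rewrite min_r ?max_l ?gerDl ?(ltW x0)// => /andP[_ cs].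
by rewrite ler_wnM2r ?(ltW x0)// f_nd.
Qed.

Lemma nondecreasing_primitive f (L : R) : {homo f : u v / u <= v} -> continuous f ->
  (forall s, 0 <= f s <= L * expR s) ->
  exists H, forall s : R, is_derive s 1 H (f s).
Proof.
move=> f_nd cf fL.
(* The primitive is [s |-> \int_0^(expR s) f (ln u) / u du]; the domination by
   [expR] makes the integrand bounded near 0. *)
pose phi (u : R) := f (ln u) * expR (- ln u).
have mphi : measurable_fun setT phi.
  apply: measurable_funM.
    by apply: measurableT_comp => //; exact: nondecreasing_measurable.
  apply: measurableT_comp => //.
  exact: measurableT_comp.
(* Since [phi] depends on [u] only through [ln u], the bound also covers u <= 0, where [ln] takes a
   default value. *)
have phi_bnd u : `|phi u| <= L.
  have /andP[f0 fL'] := fL (ln u).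
  rewrite ger0_norm; last by rewrite mulr_ge0 ?expR_ge0.
  by rewrite /phi expRN ler_pdivrMr ?expR_gt0.
have iphi u : lebesgue_measure.-integrable [set` Interval (BRight 0) (BRight u)] (EFin \o phi).
  apply: measurable_bounded_integrable => //.
  - by rewrite /= lebesgue_measure_itv/=; case: ifP => _; rewrite ?ltry.
  - exact: measurable_funTS.
  - by exists L; split; [exact: num_real|move=> K LK v _; rewrite /= (le_trans (phi_bnd v))// ltW].
pose W u := \int[lebesgue_measure]_(v in [set` Interval (BRight 0) (BRight u)]) phi v.
exists (W \o expR) => s.
have [] := @continuous_FTC1 R phi (BRight 0) (expR s) (expR s + 1) _ (iphi _) _ _.
- by rewrite ltrDl.
- exact: expR_gt0.
- have cln : {for expR s, continuous (@ln R)} by apply: continuous_ln; exact: expR_gt0.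
  apply: continuousM.
    by apply: continuous_comp => //; exact: cf.
  apply: continuous_comp; last exact: continuous_expR.
  by apply: continuousN.
rewrite -/W => dW W'.
have dW' : is_derive (expR s) 1 W (f s * expR (- s)).
  have := derivableP dW; rewrite -derive1E W' /phi expRK; exact.
apply: is_derive_eq.
by rewrite -mulrA -expRD addrC subrr expR0 mulr1.
Qed.

(* [expR x * (D x - C)] is nonincreasing and tends to 0 at -oo. *)
Lemma bounded_ode_le D D' (B C : R) : (forall x : R, is_derive x 1 D (D' x)) ->
  (forall x, D x <= B) -> (forall x, D' x + D x <= C) -> forall x, D x <= C.
Proof.
move=> dD DB DC x; rewrite leNgt; apply/negP => Cx.
pose g : R -> R := expR * (D - cst C).
pose g' u := expR u * (D' u + D u - C).
have dg (u : R) : is_derive u 1 g (g' u).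
  apply: is_derive_eq; rewrite /g' /= /cst subr0.
  rewrite /GRing.scale/= !fctE; lra.
have K0 : 0 < 2 * (B - C) by have := DB x; lra.
have q0 : 0 < (D x - C) / (2 * (B - C)) by rewrite divr_gt0// subr_gt0.
(* Chosen so that expR x0 * (B - C) is half of [g x]: then g x0 <= g x / 2 < g x, although x0 <=
   x. *)
pose x0 := x + ln ((D x - C) / (2 * (B - C))).
have x0x : x0 <= x.
  rewrite gerDl ln_le0// ler_pdivrMr// mul1r.
  have := DB x; lra.
have [c _ gc] := is_derive_MVT g g' x0 x dg.
have : g x <= g x0.
  rewrite -subr_le0 gc mulr_le0_ge0 ?subr_ge0//.
  by rewrite mulr_ge0_le0 ?expR_ge0// subr_le0.
have -> : g x0 = (expR x * ((D x - C) / (2 * (B - C)))) * (D x0 - C).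
  by rewrite /g !fctE/= /x0 expRD lnK.
rewrite {1}/g !fctE/= -mulrA ler_pM2l ?expR_gt0//.
rewrite mulrAC ler_pdivlMr//.
have := DB x0; nra.
Qed.

End real_functions.

(** * The modulus of continuity on a logarithmic scale *)

Section modulus.
Context {R : realType}.
Variables (y : R -> R) (B L : R).
Hypothesis y_bnd : forall x, `|y x| <= B.
Hypothesis y_lip : forall a b, `|y b - y a| <= L * `|b - a|.

Let L0 : 0 <= L.
Proof. by have := y_lip 0 1; rewrite subr0 normr1 mulr1; apply: le_trans. Qed.

(* Absolute values are superfluous: the set of increments is symmetric. *)
Definition log_modulus (s : R) :=
  sup [set z | exists p h, `|h| <= expR s /\ z = y (p + h) - y p].

Let log_modulus_has_sup s :
  has_sup [set z | exists p h, `|h| <= expR s /\ z = y (p + h) - y p].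
Proof.
split.
  by exists (y (0 + 0) - y 0), 0, 0; rewrite normr0 expR_ge0.
exists (B + B) => _ [p [h [_ ->]]].
have := y_bnd p; have := y_bnd (p + h); rewrite !ler_norml; lra.
Qed.

Lemma le_log_modulus s p h : `|h| <= expR s -> y (p + h) - y p <= log_modulus s.
Proof.
move=> hs; apply: ub_le_sup; last by exists p, h.
exact: (log_modulus_has_sup s).2.
Qed.

Lemma log_modulus_le s c :
  (forall p h, `|h| <= expR s -> y (p + h) - y p <= c) -> log_modulus s <= c.
Proof.
move=> hc; apply: ge_sup; first exact: (log_modulus_has_sup s).1.
by move=> _ [p [h [hs ->]]]; exact: hc.
Qed.

Lemma log_modulus_nd : {homo log_modulus : s t / s <= t}.
Proof.
move=> s t st; apply: log_modulus_le => p h hs; apply: le_log_modulus.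
by rewrite (le_trans hs)// ler_expR.
Qed.

Lemma log_modulus_ge0 s : 0 <= log_modulus s.
Proof.
have := le_log_modulus s 0 0; rewrite normr0 addr0 subrr; apply.
exact: expR_ge0.
Qed.

Lemma log_modulus_bnd s : log_modulus s <= B + B.
Proof.
apply: log_modulus_le => p h _.
have := y_bnd p; have := y_bnd (p + h); rewrite !ler_norml; lra.
Qed.

(** The decay at -oo: it lets a primitive be built by integrating from there, and forces a constant
    modulus to be zero. *)
Lemma log_modulus_expR s : log_modulus s <= L * expR s.
Proof.
apply: log_modulus_le => p h hs.
rewrite (le_trans (ler_norm _))// (le_trans (y_lip _ _))//.
by rewrite [p + h - p]addrAC subrr add0r ler_wpM2l.
Qed.

Let log_modulus_lip s t : s <= t ->
  log_modulus t <= log_modulus s + L * (expR t - expR s).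
Proof.
move=> st; apply: log_modulus_le => p h ht.
(* The increment [h] is cut at [h * r]: the first piece is admissible at scale [s], and the rest has
   length at most expR t - expR s. *)
pose r := expR s / expR t.
have r0 : 0 <= r by rewrite divr_ge0 ?expR_ge0.
have r1 : r <= 1 by rewrite ler_pdivrMr ?expR_gt0// mul1r ler_expR.
have rt : r * expR t = expR s by rewrite divfK// gt_eqF// expR_gt0.
have hr : `|h * r| <= expR s.
  by rewrite normrM (ger0_norm r0) mulrC -rt ler_wpM2l.
have := le_log_modulus s p (h * r) hr.
have := y_lip (p + h * r) (p + h).
have -> : p + h - (p + h * r) = h * (1 - r) by lra.
rewrite normrM (@ger0_norm _ (1 - r)) ?subr_ge0//.
have : L * (`|h| * (1 - r)) <= L * (expR t - expR s).
  rewrite ler_wpM2l// -rt; nra.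
have := ler_norm (y (p + h) - y (p + h * r)); lra.
Qed.

Lemma log_modulus_continuous : continuous log_modulus.
Proof.
have lip s t : `|log_modulus s - log_modulus t| <= L * `|expR s - expR t|.
  wlog st : s t / s <= t.
    move=> h; have [|/ltW] := leP s t; first exact: h.
    by rewrite distrC [`|expR s - _|]distrC; exact: h.
  have ost := log_modulus_nd _ _ st.
  have est : expR s <= expR t by rewrite ler_expR.
  rewrite (distrC (log_modulus s)) (distrC (expR s)) !ger0_norm ?subr_ge0//.
  by rewrite lerBlDl log_modulus_lip.
move=> s; apply/cvgrPdist_le => e e0.
have L1 : 0 < L + 1 by rewrite ltr_wpDl.
have /cvgrPdist_le/(_ (e / (L + 1)) (divr_gt0 e0 L1)) := @continuous_expR R s.
apply: filterS => t ht; rewrite (le_trans (lip _ _))//.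
rewrite (le_trans (ler_wpM2l L0 ht))// mulrA ler_pdivrMr//; lra.
Qed.

Lemma log_modulus_cst : (forall s t, log_modulus s = log_modulus t) ->
  forall x, y x = y 0.
Proof.
move=> cst.
have om0 s : log_modulus s <= 0.
  rewrite leNgt; apply/negP => s0.
  have L1 : 0 < L + 1 by rewrite ltr_wpDl.
  (* At this scale the Lipschitz bound is L / (L + 1) times the constant value, hence strictly
     smaller; L + 1 covers L = 0. *)
  have := log_modulus_expR (ln (log_modulus s / (L + 1))).
  rewrite lnK ?posrE ?divr_gt0// (cst _ s) mulrA ler_pdivlMr//; lra.
have le_y a b : y b - y a <= 0.
  (* Any scale admitting [b - a] will do; this one also works for a = b. *)
  have h : `|b - a| <= expR `|b - a|.
    by rewrite (le_trans _ (expR_ge1Dx _))// lerDr.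
  have := le_log_modulus _ a _ h; rewrite subrKC => /le_trans; apply; exact: om0.
by move=> x; have := le_y x 0; have := le_y 0 x; lra.
Qed.

End modulus.

(** An integrable function is finite almost surely, which excludes [alpha t = 0]; elsewhere [lne]
    and [ln] agree. *)
Lemma log_abs_centered_ln {R : realType} {d : measure_display}
    {T : measurableType d} {P : probability T R} {alpha : {RV P >-> R}} :
  log_abs_centered alpha ->
  {ae P, forall t, alpha t != 0} /\
  P.-integrable setT (EFin \o (fun t => ln `|alpha t|)) /\
  \int[P]_t ln `|alpha t| = 0.
Proof.
move=> [iln Eln].
have alpha0 : {ae P, forall t, alpha t != 0}.
  apply: filterS (integrable_ae measurableT iln) => t /(_ I).
  by have [->|//] := eqVneq (alpha t) 0; rewrite normr0 le0_lneNy.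
have ln_ae : {ae P, forall t, lne `|alpha t|%:E = (ln `|alpha t|)%:E}.
  by apply: filterS alpha0 => t a0; rewrite lne_EFin// normr_gt0.
have mlne : measurable_fun setT (fun t => lne `|alpha t|%:E).
  exact: measurable_int iln.
have mln : measurable_fun setT (fun t => (ln `|alpha t|)%:E).
  apply/measurable_EFinP; apply: measurableT_comp; first exact: measurable_ln.
  exact: measurableT_comp.
split=> //; split.
  apply/integrableP; split=> //.
  move/integrableP : iln => [_]; apply: le_lt_trans.
  rewrite (@ge0_ae_eq_integral _ _ _ P setT _ (fun t => `|lne `|alpha t|%:E|)%E)//.
  - exact: measurableT_comp.
  - exact: measurableT_comp.
  - by apply: filterS ln_ae => t /= -> _.
rewrite /Rintegral (@ae_eq_integral _ _ _ P setT (fun t => lne `|alpha t|%:E))//.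
  by rewrite Eln.
by apply: filterS ln_ae => t /= -> _.
Qed.

(** * From the functional equation to subharmonicity of the modulus *)

Section bounded_solution.
Context {R : realType} {d : measure_display} {T : measurableType d}.
Variables (P : probability T R) (alpha gamma : {RV P >-> R}) (y : R -> R).
Hypothesis hy : bounded_solution alpha gamma y.

Let dy (x : R) : is_derive x 1 y (derive1 y x).
Proof. by case: hy => _ dy _; rewrite derive1E; exact/derivableP. Qed.

Let cy : continuous y.
Proof.
move=> x; apply/differentiable_continuous/derivable1_diffP.
by have := dy x => -[].
Qed.

Let y_bounded : exists B, forall x, `|y x| <= B.
Proof.
case: hy => -[M [_ yM]] _ _; exists (M + 1) => x.
by apply: yM => //; rewrite ltrDl.
Qed.

Let integrable_y x : P.-integrable setT
  (EFin \o (fun t => y (alpha t * (x - gamma t)))).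
Proof.
have [B yB] := y_bounded.
apply: measurable_bounded_integrable => //.
- by rewrite /= probability_setT ltry.
- apply: measurableT_comp; first exact: continuous_measurable_fun.
  apply: measurable_funM => //; exact: measurable_funB.
- exists B; split; first exact: num_real.
  by move=> K BK t _; rewrite /= (le_trans (yB _))// ltW.
Qed.

Let y_eq x : derive1 y x + y x = \int[P]_t y (alpha t * (x - gamma t)).
Proof. by case: hy => _ _ /(_ x); rewrite unlock /Rintegral => <-. Qed.

(** By the equation, y' is a mean of values of [y] minus a value of [y], so it is bounded by twice
    the bound of [y]. *)
Lemma bounded_solution_lipschitz : exists B, (forall x, `|y x| <= B) /\
  (forall a b, `|y b - y a| <= (B + B) * `|b - a|).
Proof.
have [B yB] := y_bounded; exists B; split=> // a b.
have [c _ ->] := is_derive_MVT _ _ a b dy.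
rewrite normrM ler_wpM2r// -[derive1 y c](addrK (y c)) y_eq.
rewrite (le_trans (ler_normB _ _))// lerD//.
rewrite (le_trans (le_normr_Rintegral measurableT (integrable_y c)))//.
have iB : P.-integrable setT (EFin \o cst B).
  exact: finite_measure_integrable_cst.
rewrite (@le_trans _ _ (\int[P]_t B))//; last first.
  by rewrite Rintegral_cst//= probability_setT mulr1.
apply: le_Rintegral => //.
exact: integrable_norm (integrable_y c).
Qed.

(** For a fixed shift [h], D' + D is the mean of increments of [y] over [alpha t * h], whose size is
    at most exp(s + ln |alpha|); [gamma] only moves their base points. The maximum principle passes
    the resulting bound on to D. *)
Lemma log_modulus_subharmonic s :
  log_modulus y s <= \int[P]_t log_modulus y (s + ln `|alpha t|).
Proof.
have [B [yB yL]] := bounded_solution_lipschitz.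
pose f := log_modulus y; rewrite -/f.
have ifs : P.-integrable setT (EFin \o (fun t => f (s + ln `|alpha t|))).
  apply: measurable_bounded_integrable => //.
  - by rewrite /= probability_setT ltry.
  - apply: measurableT_comp.
      apply: nondecreasing_measurable => //; exact: (log_modulus_nd _ _ yB).
    apply: measurable_funD => //.
    apply: measurableT_comp; first exact: measurable_ln.
    exact: measurableT_comp.
  - exists (B + B); split; first exact: num_real.
    move=> K BK t _; rewrite /= ger0_norm ?(log_modulus_ge0 _ _ yB)//.
    by rewrite (le_trans (log_modulus_bnd _ _ yB _))// ltW.
apply: (log_modulus_le _ _ yB) => p h hs.
pose D x := y (x + h) - y x.
have dD (x : R) : is_derive x 1 D (derive1 y (x + h) - derive1 y x).
  have dyh : is_derive x 1 (y \o shift h) (derive1 y (x + h) * 1).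
    apply: is_derive1_comp; last exact: is_derive_shift.
    exact: dy.
  by have := is_deriveB dyh (dy x); rewrite mulr1.
apply: (bounded_ode_le D _ (B + B) _ dD) => x.
  have := yB x; have := yB (x + h); rewrite /D !ler_norml; lra.
have -> : derive1 y (x + h) - derive1 y x + D x =
    (derive1 y (x + h) + y (x + h)) - (derive1 y x + y x) by rewrite /D; lra.
rewrite !y_eq -RintegralB//; apply: le_Rintegral => //.
  exact: (@integrableB _ _ _ P _ measurableT _ _ (integrable_y (x + h)) (integrable_y x)).
move=> t _.
have -> : alpha t * (x + h - gamma t) = alpha t * (x - gamma t) + alpha t * h by lra.
(* Here [ln 0 = 0] carries no meaning, but the increment is zero and the modulus nonnegative. *)
have [a0|a0] := eqVneq (alpha t) 0.
  by rewrite a0 !mul0r addr0 subrr (log_modulus_ge0 _ _ yB).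
apply: (le_log_modulus _ _ yB).
by rewrite normrM expRD lnK ?posrE ?normr_gt0// mulrC ler_wpM2r.
Qed.

End bounded_solution.

(** * Constancy of bounded solutions, with xi = ln |alpha| and f = [log_modulus y] *)

Theorem theorem1p3 (R : realType) (d : measure_display) (T : measurableType d)
    (P : probability T R) (alpha gamma : {RV P >-> R})
    (halpha1 : (0 < P [set t | (`|alpha t| != 1)%R])%E)
    (hlog : log_abs_centered alpha)
    (y : R -> R) (hy : bounded_solution alpha gamma y) :
  exists c : R, forall x : R, y x = c.
Proof.
have [alpha0 [iln Eln]] := log_abs_centered_ln hlog.
have [B [yB yL]] := bounded_solution_lipschitz _ _ _ _ hy.
have f_nd := log_modulus_nd _ _ yB.
have [H dH] : exists H, forall s : R, is_derive s 1 H (log_modulus y s).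
  apply: (nondecreasing_primitive _ (B + B) f_nd).
    exact: log_modulus_continuous yB yL.
  by move=> s; rewrite (log_modulus_ge0 _ _ yB) (log_modulus_expR _ _ _ yB yL).
exists (y 0); apply: (log_modulus_cst _ _ _ yB yL).
have mxi : measurable_fun setT (fun t => ln `|alpha t|).
  by apply/measurable_EFinP; exact: measurable_int iln.
apply: (subharmonic_cst P _ mxi iln Eln _ H (B + B) f_nd).
- exact: log_modulus_ge0 yB.
- exact: log_modulus_bnd yB.
- by move=> s x; exact: derive_subgradient.
- exact: log_modulus_subharmonic hy.
rewrite lt_neqAle measure_ge0 andbT; apply/eqP => /esym xi0.
have mneq (g : T -> R) (r : R) : measurable_fun setT g -> measurable [set t | g t != r].
  move=> mg; rewrite (_ : [set t | _] = g @^-1` (~` [set r])).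
    by rewrite -[X in measurable X]setTI; apply: mg => //; apply: measurableC.
  by apply/seteqP; split => t /= /eqP.
(* A zero of ln |alpha| means |alpha| = 1 or, by the default value, alpha = 0. So |alpha| != 1
   implies ln |alpha| != 0 or alpha = 0, both null events here. *)
have neg : P.-negligible [set t | `|alpha t| != 1].
  have := negligibleU alpha0 ((negligibleP P (mneq _ _ mxi)).2 xi0).
  apply: negligibleS => t /= a1.
  have [a0|a0] := eqVneq (alpha t) 0; [left|right].
    by [].
  by rewrite ln_eq0 ?normr_gt0.
have mabs : measurable_fun setT (fun t => `|alpha t|) by exact: measurableT_comp.
by move: halpha1; rewrite (negligibleP P (mneq _ _ mabs)).1 ?ltxx.
Qed.
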